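(* The class $\mathcal{C}$ of all finite digraphs that have an oriented cycle with non-zero net length can be decided by an adaptive right unbounded query algorithm over $\mathbb{B}$, and not by an adaptive right $k$-query algorithm over $\mathbb{B}$, for any $k$.
   Context: Digraphs are finite structures $(V,R)$, $V\neq\varnothing$, $R\subseteq V\times V$; $\mathsf{FIN}$ is the class of all digraphs. An oriented walk is $(a_0,r_0,a_1,\dots,a_n,r_n,a_{n+1})$ with $r_i\in\{+,-\}$, where $r_i=+$ requires $(a_i,a_{i+1})\in R$ and $r_i=-$ requires $(a_{i+1},a_i)\in R$; its net length is $\#\{i:r_i=+\}-\#\{i:r_i=-\}$; an oriented cycle is such a walk with $a_{n+1}=a_0$, $n\ge0$, and $a_0,\dots,a_n$ pairwise distinct. $\hom_{\mathbb{B}}(A,F)$ is $1$ if there is a homomorphism $A\to F$ and $0$ otherwise. For a set $\Sigma$, $\Sigma^{<\omega}$ is the set of finite strings over $\Sigma$; a subtree is a prefix-closed subset, a leaf an element with no proper extension. An adaptive right query algorithm over $\mathbb{B}$ is a function $G:\mathcal{T}\to\mathsf{FIN}\cup\{\mathsf{YES},\mathsf{NO}\}$ with $\mathcal{T}\subseteq\{0,1\}^{<\omega}$ a subtree and $G(\sigma)\in\{\mathsf{YES},\mathsf{NO}\}$ iff $\sigma$ is a leaf; its computation path on $A$ is the limit of $\sigma_0=\varepsilon$, $\sigma_{i+1}=\sigma_i$ if $G(\sigma_i)\in\{\mathsf{YES},\mathsf{NO}\}$, else $\sigma_{i+1}=\sigma_i\bullet\hom_{\mathbb{B}}(A,G(\sigma_i))$;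 it must be total (finite path for every input), is called unbounded in general, and decides $\{A:G(\text{path of }A)=\mathsf{YES}\}$. It is an adaptive right $k$-query algorithm if all computation paths have length at most $k$. *)

(* Defs.v *)
From mathcomp Require Import all_boot all_order all_algebra.

Set Implicit Arguments.
Unset Strict Implicit.
Unset Printing Implicit Defensive.

Import GRing.Theory.

Record digraph := Digraph {
  vertex :> finType;
  arc : rel vertex;
  vertex_gt0 : 0 < #|vertex|
}.

Definition hom_B (A F : digraph) : bool :=
  [exists f : {ffun A -> F}, [forall x, forall y, arc x y ==> arc (f x) (f y)]].

(* The walk (a_0, r_0, a_1, ..., r_n, a_(n+1)) is given by its origin a_0 and  *)
(* its steps [:: (r_0, a_1); ...; (r_n, a_(n+1))], with true for + and false   *)
(* for -.                                                                      *)
Fixpoint oriented_walk (A : digraph) (x : A) (s : seq (bool * A)) : bool :=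
  if s is (r, y) :: s' then
    (if r then arc x y else arc y x) && oriented_walk y s'
  else true.

Definition net_length (A : digraph) (s : seq (bool * A)) : int :=
  ((count (fun p => p.1) s)%:Z - (count (fun p => ~~ p.1) s)%:Z)%R.

(* belast x (unzip2 s) is the sequence a_0, ..., a_n. *)
Definition oriented_cycle (A : digraph) (x : A) (s : seq (bool * A)) : bool :=
  [&& s != [::], oriented_walk x s, last x (unzip2 s) == x
    & uniq (belast x (unzip2 s))].

Definition has_unbalanced_cycle (A : digraph) : Prop :=
  exists (x : A) (s : seq (bool * A)),
    oriented_cycle x s /\ net_length s <> 0%R.

Inductive label := Query of digraph | Yes | No.

Definition is_answer (l : label) : bool :=
  if l is Query _ then false else true.

Definition subtree (T : pred (seq bool)) : Prop :=
  forall s t : seq bool, prefix s t -> T t -> T s.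

Definition leaf (T : pred (seq bool)) (s : seq bool) : Prop :=
  T s /\ forall t : seq bool, T t -> prefix s t -> t = s.

(* A labelling is a partial function on strings; its domain is the tree. *)
Definition labelling := seq bool -> option label.

Definition tree (G : labelling) : pred (seq bool) := fun s => isSome (G s).

Definition step (G : labelling) (A : digraph) (s : seq bool) : seq bool :=
  if G s is Some (Query F) then rcons s (hom_B A F) else s.

Definition computation (G : labelling) (A : digraph) (i : nat) : seq bool :=
  iter i (step G A) [::].

(* The limit of the computation, when it is a finite string. *)
Definition computation_path (G : labelling) (A : digraph) (s : seq bool) : Prop :=
  exists i, forall j, i <= j -> computation G A j = s.

(* A computation that leaves the tree gets stuck there, hence the condition    *)
(* tree G s. In particular totality forces the empty string into the tree.     *)
Definition total_labelling (G : labelling) : Prop :=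
  forall A : digraph, exists s, computation_path G A s /\ tree G s.

Definition right_query_algorithm (G : labelling) : Prop :=
  [/\ subtree (tree G),
      forall s l, G s = Some l -> (is_answer l <-> leaf (tree G) s)
    & total_labelling G].

Definition right_k_query_algorithm (k : nat) (G : labelling) : Prop :=
  right_query_algorithm G /\
  forall A s, computation_path G A s -> size s <= k.

Definition decides (G : labelling) (C : digraph -> Prop) : Prop :=
  forall A, C A <-> exists s, computation_path G A s /\ G s = Some Yes.

(* Main.v *)
Require Import Defs.
From mathcomp Require Import all_boot all_order all_algebra.
From Stdlib Require Import Classical.
From mathcomp Require Import zify.
(* Otherwise [arc] denotes [path.arc]. *)
Import Defs.

(* A digraph has no unbalanced cycle iff it maps to some directed path
   [P_n]: without unbalanced cycles the net length of a walk depends only on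
   its endpoints, so it defines a level function.  Balanced digraphs then map
   to every directed cycle, whereas a cycle of net length [m <> 0] obstructs
   homomorphisms to directed cycles whose length does not divide [m].
   Asking about [P_0, C_1, P_1, C_2, ...] until some [P_n] is hit or some
   [C_n] is missed therefore decides the class.

   Finitely many queries involve only digraphs [F] with at most [N] vertices,
   for some [N].  The balanced [P_N] and the unbalanced directed cycle of
   length [N!] map to the same such [F]: a homomorphism from [P_N] to [F]
   repeats a vertex, so [F] has a closed directed walk of some length
   [d <= N], around which the cycle of length [N!] can be wrapped. *)

Set Implicit Arguments.
Unset Strict Implicit.
Unset Printing Implicit Defensive.

Import Order.TTheory GRing.Theory Num.Theory.

(** * Homomorphisms between directed paths, directed cycles and small digraphs *)

Lemma hom_BP (A F : digraph) :
  reflect (exists f : A -> F, forall x y, arc x y -> arc (f x) (f y))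
          (hom_B A F).
Proof.
apply: (iffP existsP) => [[f /forallP hf]|[f hf]].
  by exists f => x y; move/forallP: (hf x) => /(_ y) /implyP.
exists (finfun f); apply/forallP => x; apply/forallP => y; apply/implyP.
by rewrite !ffunE; exact: hf.
Qed.

Lemma hom_B_trans (A B D : digraph) : hom_B A B -> hom_B B D -> hom_B A D.
Proof.
move=> /hom_BP[f hf] /hom_BP[g hg]; apply/hom_BP.
by exists (g \o f) => x y /hf /hg.
Qed.

Lemma ord_gt0 (n : nat) : 0 < #|'I_n.+1|. Proof. by rewrite card_ord. Qed.

Definition dipath (n : nat) : digraph :=
  @Digraph 'I_n.+1 (fun i j => val j == i.+1) (ord_gt0 n).

(* The length of [dicycle n] is [n.+1]. *)
Definition dicycle (n : nat) : digraph :=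
  @Digraph 'I_n.+1 (fun i j => val j == i.+1 %% n.+1) (ord_gt0 n).

Lemma hom_dipath_dicycle (n m : nat) : hom_B (dipath n) (dicycle m).
Proof.
apply/hom_BP; exists (fun i : 'I_n.+1 => inord (i %% m.+1) : 'I_m.+1).
move=> i j /eqP /= ->.
by rewrite !inordK ?ltn_pmod // -[in X in _ == X]addn1 modnDml addn1.
Qed.

Lemma hom_dicycle_dipath (n m : nat) : ~~ hom_B (dicycle n) (dipath m).
Proof.
apply/negP => /hom_BP[f hf].
(* A vertex with the largest image still has a successor on the cycle, whose image would have to be
   larger. *)
have [i _ max_i] := @arg_maxnP 'I_n.+1 ord0 xpredT (fun i => val (f i)) isT.
have /hf/eqP e : @arc (dicycle n) i (inord (i.+1 %% n.+1)).
  by rewrite /= inordK ?ltn_pmod.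
by have := max_i (inord (i.+1 %% n.+1)) isT; rewrite e /= ltnn.
Qed.

Lemma hom_dipath_fact (N : nat) (F : digraph) :
  #|F| <= N -> hom_B (dipath N) F = hom_B (dicycle N`!.-1) F.
Proof.
move=> leFN; apply/idP/idP; last exact/hom_B_trans/hom_dipath_dicycle.
move=> /hom_BP[f hf].
have [i [j [lt_ij eq_f]]] : exists i j : 'I_N.+1, i < j /\ f i = f j.
  have /injectivePn[i [j neq_ij eq_f]] : ~~ injectiveb f.
    apply/negP => /injectiveP /leq_card; rewrite card_ord => h.
    by have := leq_trans h leFN; rewrite ltnn.
  move: neq_ij; rewrite -val_eqE neq_ltn => /orP[lt_ij|lt_ji].
    by exists i, j.
  by exists j, i.
pose d := j - i.
have d_gt0 : 0 < d by rewrite subn_gt0.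
have dvd_d : d %| (N`!.-1).+1.
  rewrite prednK ?fact_gt0 //; apply: dvdn_fact.
  by rewrite d_gt0 (leq_trans (leq_subr _ _)) // -ltnS.
have lt_id c : c < d -> i + c < N.+1.
  by move=> lt_cd; apply: leq_trans (ltn_ord j); rewrite -/d; lia.
(* The cycle winds around the closed walk [f i, ..., f j]; the winding closes up because [d] divides
   [N!]. *)
apply/hom_BP; exists (fun c : 'I__ => f (inord (i + c %% d))).
move=> c c' /eqP /= ->; rewrite modn_dvdm //.
have lt_cd := ltn_pmod c d_gt0.
have -> : c.+1 %% d = (c %% d).+1 %% d by rewrite -addn1 -modnDml addn1.
have [lt_c1d|le_dc1] := ltnP (c %% d).+1 d.
  rewrite (modn_small lt_c1d); apply: hf.
  by rewrite /= !inordK ?lt_id // addnS.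
(* At the end of a turn the next vertex is [f i], which equals [f j]. *)
have -> : (c %% d).+1 = d by apply/eqP; rewrite eqn_leq lt_cd.
rewrite modnn addn0 inord_val eq_f; apply: hf.
by rewrite /= inordK ?lt_id //; apply/eqP; rewrite -/d; lia.
Qed.

(** * Net length of walks, and level functions *)

Section Walks.

Variable A : digraph.
Implicit Types (x y : A) (s : seq (bool * A)).

Lemma net_length_nil : net_length (Nil (bool * A)) = 0%R.
Proof. by []. Qed.

Lemma net_length_cons (r : bool) y s :
  net_length ((r, y) :: s) = ((if r then 1 else - 1) + net_length s)%R.
Proof. by rewrite /net_length /=; case: r => /=; lia. Qed.

Lemma net_length_cat s t :
  net_length (s ++ t) = (net_length s + net_length t)%R.
Proof. by rewrite /net_length !count_cat; lia. Qed.

Lemma oriented_walk_cat x s t :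
  oriented_walk x (s ++ t) =
  oriented_walk x s && oriented_walk (last x (unzip2 s)) t.
Proof. by elim: s x => [|[r y] s IHs] x //=; rewrite IHs andbA. Qed.

Lemma oriented_walk_rev x s :
  oriented_walk x s ->
  exists t, [/\ oriented_walk (last x (unzip2 s)) t,
    last (last x (unzip2 s)) (unzip2 t) = x & net_length t = (- net_length s)%R].
Proof.
elim: s x => [|[r y] s IHs] x /=; first by exists [::].
case/andP=> arc_xy /IHs[t [walk_t last_t net_t]].
exists (t ++ [:: (~~ r, x)]); split.
- by rewrite oriented_walk_cat walk_t last_t /= andbT; case: r arc_xy.
- by rewrite /unzip2 map_cat last_cat.
- rewrite net_length_cat !net_length_cons net_length_nil net_t.
  by case: r {arc_xy} => /=; lia.
Qed.

(** The increments of [p] telescope along the walk. The modulus [d = 0] gives an exact equality and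
    serves for paths; a positive [d] serves for cycles. *)
Lemma walk_net_length_mod (p : A -> int) (d : int) x s :
  (forall x y, arc x y -> (d %| (p y - p x - 1)%R)%Z) ->
  oriented_walk x s ->
  (d %| (p (last x (unzip2 s)) - p x - net_length s)%R)%Z.
Proof.
move=> hp; elim: s x => [|[r y] s IHs] x /=.
  by rewrite net_length_nil subrr subr0 dvdz0.
case/andP=> arc_xy /IHs h; rewrite net_length_cons.
case: r arc_xy => /hp h1.
  by apply: etrans (rpredD h h1); congr (d %| _)%Z; lia.
by apply: etrans (rpredB h h1); congr (d %| _)%Z; lia.
Qed.

Lemma closed_walk_split x s :
  ~~ uniq (belast x (unzip2 s)) ->
  exists s1 s2 s3, [/\ s = s1 ++ s2 ++ s3, s2 != [::], s1 ++ s3 != [::]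
    & last (last x (unzip2 s1)) (unzip2 s2) = last x (unzip2 s1)].
Proof.
elim: s x => [|[r y] s IHs] x //=.
rewrite negb_and negbK => /orP[x_in|/IHs].
  (* The walk returns to [x] before its end, since [belast] omits the final vertex; hence [s3] is
     nonempty. *)
  have : exists s2 s3, [/\ s = s2 ++ s3, s3 != [::] & last y (unzip2 s2) = x].
    elim: s y x_in {IHs} => [|[r' z] s IHs] y //=.
    rewrite inE => /orP[/eqP->|/IHs[s2 [s3 [-> s3n0 <-]]]].
      by exists [::], ((r', z) :: s).
    by exists ((r', z) :: s2), s3.
  case=> s2 [s3 [-> s3n0 last_s2]].
  by exists [::], ((r, y) :: s2), s3.
case=> s1 [s2 [s3 [-> s2n0 _ closed_s2]]].
by exists ((r, y) :: s1), s2, s3.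
Qed.

(** Induction on the length: without repeated vertices a nonempty closed walk is an oriented cycle;
    otherwise it splits into two shorter closed walks, whose net lengths add up. *)
Lemma closed_walk_net0 x s :
  ~ has_unbalanced_cycle A -> oriented_walk x s -> last x (unzip2 s) = x ->
  net_length s = 0%R.
Proof.
move=> balA; have [n] := ubnP (size s); elim: n x s => // n IHn x s le_sn walk_s.
move=> closed_s.
have [->|sn0] := eqVneq s [::]; first exact: net_length_nil.
have [uniq_s|/closed_walk_split] := boolP (uniq (belast x (unzip2 s))).
  apply: NNPP => net_s; apply: balA; exists x, s; split=> //.
  by rewrite /oriented_cycle sn0 walk_s closed_s eqxx.
case=> s1 [s2 [s3 [def_s s2n0 s13n0 closed_s2]]].
move: walk_s closed_s le_sn; rewrite {}def_s !oriented_walk_cat closed_s2.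
rewrite /unzip2 !map_cat !last_cat -!/(unzip2 _) closed_s2 !size_cat.
case/and3P=> walk1 walk2 walk3 closed13 le_n.
have s2_gt0 : 0 < size s2 by rewrite lt0n size_eq0.
have s13_gt0 : 0 < size s1 + size s3 by rewrite -size_cat lt0n size_eq0.
have net2 : net_length s2 = 0%R by apply: (IHn _ _ _ walk2 closed_s2); lia.
have net13 : net_length (s1 ++ s3) = 0%R.
  apply: (IHn x); rewrite ?oriented_walk_cat ?walk1 ?size_cat //; first by lia.
  by rewrite /unzip2 map_cat last_cat.
by rewrite !net_length_cat net2 add0r -net_length_cat.
Qed.

Lemma net_length_endpoints x y s t :
  ~ has_unbalanced_cycle A -> oriented_walk x s -> oriented_walk x t ->
  last x (unzip2 s) = y -> last x (unzip2 t) = y -> net_length s = net_length t.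
Proof.
move=> balA walk_s /oriented_walk_rev[t' [walk_t' last_t' net_t']] eq_s eq_t.
rewrite eq_t in walk_t' last_t'.
have := @closed_walk_net0 x (s ++ t') balA.
rewrite oriented_walk_cat walk_s eq_s /unzip2 map_cat last_cat -!/(unzip2 _).
rewrite eq_s net_length_cat net_t' => /(_ walk_t' last_t') /eqP.
by rewrite subr_eq0 => /eqP.
Qed.

(** The level of [x] is the net length of a chosen walk to [x] from the root of its weak component;
    for balanced digraphs the choice does not matter. *)
Lemma balanced_potential :
  ~ has_unbalanced_cycle A ->
  exists p : A -> int, forall x y, arc x y -> p y = (p x + 1)%R.
Proof.
move=> balA.
pose e x y := arc x y || arc y x.
have e_sym : connect_sym e.
  by apply: sym_connect_sym => x y; rewrite /e orbC.
have walk_root x :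
    exists s,
      oriented_walk (fingraph.root e x) s && (last (fingraph.root e x) (unzip2 s) == x).
  have : connect e (fingraph.root e x) x by rewrite e_sym connect_root.
  case/connectP=> q; elim: q (fingraph.root e x) => [|z q IHq] y /=.
    by move=> _ ->; exists [::]; rewrite /= eqxx.
  case/andP=> /orP e_yz /IHq{}IHq /IHq[s walk_s].
  by case: e_yz => arc_yz; [exists ((true, z) :: s) | exists ((false, z) :: s)];
    rewrite /= arc_yz.
pose w x := xchoose (walk_root x).
have wP x :
    oriented_walk (fingraph.root e x) (w x) /\
    last (fingraph.root e x) (unzip2 (w x)) = x.
  by have /andP[? /eqP] := xchooseP (walk_root x).
exists (fun x => net_length (w x)) => x y arc_xy.
have eq_root : fingraph.root e y = fingraph.root e x.
  by apply/esym/eqP; rewrite fingraph.root_connect // connect1 // /e arc_xy.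
have [[walk_x last_x] [walk_y last_y]] := (wP x, wP y).
rewrite eq_root in walk_y last_y.
(* The walk to [x] followed by the arc to [y] competes with the chosen walk to [y]. *)
rewrite (@net_length_endpoints _ y (w y) (w x ++ [:: (true, y)]) balA walk_y) //.
- by rewrite net_length_cat net_length_cons net_length_nil addr0.
- by rewrite oriented_walk_cat walk_x last_x /= arc_xy.
- by rewrite /unzip2 map_cat last_cat.
Qed.

Lemma balanced_hom_dipath :
  ~ has_unbalanced_cycle A -> exists n, hom_B A (dipath n).
Proof.
move=> /balanced_potential[p hp].
pose M := \sum_(x : A) `|p x|%N.
have leM x : `|p x|%N <= M by rewrite /M (bigD1 x) //= leq_addr.
(* Adding [M] moves all levels into the interval from 0 to [M + M]. *)
exists (M + M); apply/hom_BP.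
exists (fun x => inord `|(p x + Posz M)%R|%N : 'I_(M + M).+1) => x y arc_xy /=.
have := hp x y arc_xy; have := leM x; have := leM y => hy hx hxy.
by rewrite !inordK; lia.
Qed.

Lemma hom_dipath_balanced (n : nat) :
  hom_B A (dipath n) -> ~ has_unbalanced_cycle A.
Proof.
move=> /hom_BP[f hf] [x [s [/and4P[_ walk_s /eqP closed_s _] []]]].
have := @walk_net_length_mod (fun x => Posz (val (f x))) 0 x s _ walk_s.
rewrite closed_s subrr sub0r dvd0z oppr_eq0 => /(_ _) /eqP -> //.
by move=> y z /hf /eqP /= ->; rewrite dvd0z; lia.
Qed.

Lemma unbalanced_not_hom_dicycle :
  has_unbalanced_cycle A -> exists n, ~~ hom_B A (dicycle n).
Proof.
case=> [x [s [/and4P[_ walk_s /eqP closed_s _] net_s]]].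
(* This cycle has length one more than the absolute net length, so it cannot divide that nonzero
   number. *)
exists `|net_length s|%N; apply/negP => /hom_BP[f hf].
pose m := `|net_length s|.+1%N.
have := @walk_net_length_mod (fun x => Posz (val (f x))) (Posz m) x s _ walk_s.
rewrite closed_s subrr sub0r rpredN => h.
have /h : forall y z : A,
    arc y z -> (Posz m %| (Posz (val (f z)) - Posz (val (f y)) - 1)%R)%Z.
  move=> y z /hf /eqP /= ->; rewrite -/m -addrA -opprD.
  rewrite -[(_ + 1)%R]/(Posz (f y + 1)) addn1 -eqz_mod_dvd.
  by rewrite !modz_nat modn_mod.
rewrite dvdzE /= => /dvdn_leq; rewrite ltnn absz_gt0 => /(_ _)/negP.
by apply=> //; apply/eqP.
Qed.

End Walks.

Lemma not_hom_dicycle_unbalanced (A : digraph) (n : nat) :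
  ~~ hom_B A (dicycle n) -> has_unbalanced_cycle A.
Proof.
move=> nhom; apply: NNPP => /balanced_hom_dipath[m hom_m].
by rewrite (hom_B_trans hom_m (hom_dipath_dicycle _ _)) in nhom.
Qed.

(** * The unbounded search algorithm *)

Lemma computation_path_uniq (G : labelling) (A : digraph) (s t : seq bool) :
  computation_path G A s -> computation_path G A t -> s = t.
Proof.
move=> [i hi] [j hj].
by rewrite -(hi (maxn i j)) ?leq_maxl // hj ?leq_maxr.
Qed.

Definition query (n : nat) : digraph :=
  if odd n then dicycle n./2 else dipath n./2.

(* The algorithm goes on as long as paths are answered by 0 and cycles by 1. *)
Definition undecided (n : nat) : seq bool := mkseq odd n.

(** The tree is a single infinite branch of undecided strings with one leaf hanging off each. A leaf
    ending in 1 records a path that was hit, one ending in 0 a cycle that was missed. *)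
Definition search : labelling := fun s =>
  if take (size s).-1 s == undecided (size s).-1 then
    Some (if s == undecided (size s) then Query (query (size s))
          else if last true s then No else Yes)
  else None.

Lemma take_undecided (m n : nat) :
  m <= n -> take m (undecided n) = undecided m.
Proof.
by move=> le_mn; rewrite /undecided /mkseq -map_take take_iota (minn_idPl le_mn).
Qed.

Lemma undecidedS (n : nat) : undecided n.+1 = rcons (undecided n) (odd n).
Proof. exact: mkseqS. Qed.

Lemma size_undecided (n : nat) : size (undecided n) = n.
Proof. exact: size_mkseq. Qed.

Lemma tree_search (s : seq bool) :
  tree search s = (take (size s).-1 s == undecided (size s).-1).
Proof. by rewrite /tree /search; case: ifP. Qed.

Lemma tree_search_rcons (n : nat) (b : bool) :
  tree search (rcons (undecided n) b).
Proof.
by rewrite tree_search size_rcons -cats1 take_size_cat size_undecided.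
Qed.

Lemma search_undecided (n : nat) : search (undecided n) = Some (Query (query n)).
Proof.
by rewrite /search size_undecided take_undecided ?leq_pred // !eqxx.
Qed.

Lemma search_rcons (n : nat) :
  search (rcons (undecided n) (~~ odd n)) = Some (if odd n then Yes else No).
Proof.
have := tree_search_rcons n (~~ odd n); rewrite tree_search /search => ->.
rewrite size_rcons size_undecided undecidedS eqseq_rcons last_rcons.
by rewrite eqxx /=; case: (odd n).
Qed.

Lemma subtree_search : subtree (tree search).
Proof.
move=> s t; rewrite !tree_search => /prefixP[u ->] /eqP h.
have le_st : (size s).-1 <= (size (s ++ u)).-1 by rewrite size_cat; lia.
have := congr1 (take (size s).-1) h.
rewrite take_undecided // -[X in X = _ -> _]take_min (minn_idPl le_st).
by rewrite takel_cat ?leq_pred // => ->.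
Qed.

Lemma leaf_search (s : seq bool) (l : label) :
  search s = Some l -> (is_answer l <-> leaf (tree search) s).
Proof.
move=> def_l; have tree_s : tree search s by rewrite /tree def_l.
have [def_s|neq_s] := eqVneq s (undecided (size s)).
  move: def_l; rewrite def_s search_undecided => -[<-]; split=> // -[_ leaf_s].
  have := leaf_s _ (tree_search_rcons _ true) (prefix_rcons _ _).
  by move/(congr1 size)/eqP; rewrite size_rcons eqn_leq ltnn.
have -> : is_answer l.
  move: def_l; rewrite /search (negPf neq_s); case: ifP => // _ [<-].
  by case: last.
split=> // _; split=> // t; rewrite tree_search => /eqP tree_t /prefixP[u def_t].
case: u def_t => [|b u] def_t; first by rewrite def_t cats0.
(* A proper extension of [s] in the tree would make [s] a prefix of an undecided string, hence
   undecided. *)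
case/eqP: neq_s; have le_st : size s <= (size t).-1 by rewrite def_t size_cat /=; lia.
have := congr1 (take (size s)) tree_t.
rewrite take_undecided // -[X in X = _ -> _]take_min (minn_idPl le_st).
by rewrite def_t take_size_cat.
Qed.

Lemma search_stops (A : digraph) :
  exists n, hom_B A (query n) = ~~ odd n /\
    computation_path search A (rcons (undecided n) (~~ odd n)).
Proof.
have stop : exists n, hom_B A (query n) == ~~ odd n.
  have [/unbalanced_not_hom_dicycle|/balanced_hom_dipath] :=
    classic (has_unbalanced_cycle A); case=> n hom_n.
    exists n.*2.+1; rewrite /query /= odd_double uphalf_double.
    by rewrite (negPf hom_n).
  by exists n.*2; rewrite /query /= odd_double doubleK hom_n.
(* The search leaves the infinite branch at the least query with a decisive answer. *)
case: (ex_minnP stop) => n /eqP hom_n min_n; exists n; split=> //.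
have comp_und m : m <= n -> computation search A m = undecided m.
  elim: m => // m IHm lt_mn; rewrite /computation iterS -/(computation _ _ _).
  rewrite IHm 1?ltnW // /step search_undecided undecidedS.
  have : hom_B A (query m) != ~~ odd m.
    by apply: contraL lt_mn => /min_n; rewrite -leqNgt.
  by case: hom_B; case: (odd m).
exists n.+1; elim=> // j IHj; rewrite leq_eqVlt => /orP[/eqP[<-]|].
  rewrite /computation iterS -/(computation _ _ _) comp_und //.
  by rewrite /step search_undecided hom_n.
rewrite ltnS => /IHj; rewrite /computation iterS => ->.
by rewrite /step search_rcons; case: (odd n).
Qed.

Lemma right_query_algorithm_search : right_query_algorithm search.
Proof.
split; [exact: subtree_search | exact: leaf_search |].
move=> A; have [n [_ path_n]] := search_stops A.
by exists (rcons (undecided n) (~~ odd n)); split=> //; exact: tree_search_rcons.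
Qed.

Lemma decides_search : decides search has_unbalanced_cycle.
Proof.
move=> A; have [n [hom_n path_n]] := search_stops A.
have -> : (exists s, computation_path search A s /\ search s = Some Yes) <-> odd n.
  split=> [[s [/computation_path_uniq/(_ path_n)->]]|odd_n].
    by rewrite search_rcons; case: odd.
  by exists (rcons (undecided n) (~~ odd n)); rewrite search_rcons odd_n in path_n *.
move: hom_n; rewrite /query; case: odd => hom_n; split=> //.
  by move=> _; apply: not_hom_dicycle_unbalanced (negbT hom_n).
by move/(hom_dipath_balanced hom_n).
Qed.

(** * Impossibility with boundedly many queries *)

Lemma size_step (G : labelling) (A : digraph) (s : seq bool) :
  size s <= size (step G A s).
Proof. by rewrite /step; case: (G s) => [[F||]|] //; rewrite size_rcons. Qed.

Lemma size_computation (G : labelling) (A : digraph) (k i : nat) :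
  right_k_query_algorithm k G -> size (computation G A i) <= k.
Proof.
case=> -[_ _ /(_ A)[s [path_s _]]] /(_ A s path_s); apply: leq_trans.
have [j eq_j] := path_s.
rewrite -(eq_j (j + i)) ?leq_addr //; elim: {eq_j}j => // j IHj.
exact: leq_trans IHj (size_step _ _ _).
Qed.

(** There are finitely many strings of length at most [k], and the sum of all their query sizes
    dominates each one. *)
Lemma query_size_bound (G : labelling) (k : nat) :
  exists N, forall s F, size s <= k -> G s = Some (Query F) -> #|F| <= N.
Proof.
pose c s := if G s is Some (Query F) then #|F| else 0.
exists (\sum_(n < k.+1) \sum_(t : n.-tuple bool) c t) => s F le_sk def_F.
rewrite (bigD1 (Ordinal (le_sk : size s < k.+1))) //=.
by rewrite (bigD1 (in_tuple s)) //= {1}/c def_F -addnA leq_addr.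
Qed.

Lemma computation_eq (G : labelling) (A B : digraph) (k : nat) :
  right_k_query_algorithm k G ->
  (forall s F, size s <= k -> G s = Some (Query F) -> hom_B A F = hom_B B F) ->
  forall i, computation G A i = computation G B i.
Proof.
move=> algG homAB; elim=> // i IHi.
rewrite /computation !iterS -!/(computation _ _ _) -IHi /step.
case def_F: (G _) => [[F||]|] //.
by rewrite (homAB _ _ (size_computation A i algG) def_F).
Qed.

Theorem theorem29 :
  (exists G : labelling,
     right_query_algorithm G /\ decides G has_unbalanced_cycle) /\
  (forall k : nat, ~ exists G : labelling,
     right_k_query_algorithm k G /\ decides G has_unbalanced_cycle).
Proof.
split.
  exists search.
  by split; [exact: right_query_algorithm_search | exact: decides_search].
move=> k [G [algG decG]]; have [N boundN] := query_size_bound G k.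
pose A := dicycle N`!.-1; pose B := dipath N.
have unbalA : has_unbalanced_cycle A.
  (* If balanced, the directed cycle would map to a directed path. *)
  apply: NNPP => /balanced_hom_dipath[n].
  exact/negP/hom_dicycle_dipath.
have idB : hom_B B B by apply/hom_BP; exists id.
apply: (hom_dipath_balanced idB); apply/decG.
have [s [[i path_s] yes_s]] := (decG A).1 unbalA.
exists s; split=> //; exists i => j /path_s <-.
apply/esym/(computation_eq algG) => t F le_tk def_F.
exact/esym/hom_dipath_fact/(boundN _ _ le_tk def_F).
Qed.
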